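(* There is no orientable no-fold product structure, even or odd, with $|A|,|B|\ge 2$, such that $\operatorname{girth}(L_1)\ge 6$, $\operatorname{girth}(L_A)\ge 5$ and $\operatorname{girth}(L_B)\ge 5$. Hence for every orientable no-fold product structure, even or odd, with $|A|,|B|\ge2$, $\operatorname{girth}(L_1)=6$ implies $\operatorname{girth}(L_{AB})\le 4$; and the number $p^\ast$, defined as the least integer $p\ge 3$ such that there is no orientable no-fold product structure $\Pi$ (even or odd, with $|A|,|B|\ge 2$) with $\operatorname{girth}(L_{AB}(\Pi))\ge p$ and $\operatorname{girth}(L_1(\Pi))\ge 6$, satisfies $p^\ast=5$.
   Context: A product structure of type $(m,n)$ is a triple $\Pi=(A,B,P)$ with $A,B$ finite (disjoint) sets, $|A|=m$, $|B|=n$, and $P$ a partition of $A\times B$ into cells such that if two distinct positions $(a,b),(a',b')$ lie in the same cell then $a\ne a'$ and $b\ne b'$. It is even if every cell has size $2$, and odd if exactly one cell has size $1$ and all others have size $2$. Horizontal graphs: $L_A$ is the simple graph on $A$ in which $\{a,a'\}$ is an edge iff there are $b,b'\in B$ with $\{(a,b),(a',b')\}\in P$; $L_B$ is the simple graph on $B$ in which $\{b,b'\}$ is an edge iff there are $a,a'\in A$ with $\{(a,b),(a',b')\}\in P$. $L_{AB}=L_A\sqcup L_B$. Colors are the classes of the equivalence relation on $E(L_A)\sqcup E(L_B)$ generated by declaring, for each 2-cell $\{(a,b),(a',b')\}$, the edge $\{a,a'\}$ equivalent to the edge $\{b,b'\}$. A coherent orientation $O$ is a choice of one direction for each edge of $L_A$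 and $L_B$ such that for every 2-cell $\{(a,b),(a',b')\}$ either $a\to a'$ and $b\to b'$, or $a'\to a$ and $b'\to b$. $(\Pi,O)$ is no-fold if no vertex has two distinct outgoing edges of the same color or two distinct incoming edges of the same color. An orientable no-fold product structure is one admitting a coherent orientation $O$ with $(\Pi,O)$ no-fold, considered together with any one such fixed $O$. Each color $c$ has two signed colors $(c,\mathrm{out}),(c,\mathrm{in})$. The middle link $L_1$ is the simple bipartite graph with parts $A\sqcup B$ and the set of signed colors, where $v$ is adjacent to $(c,\mathrm{out})$ iff $v$ is the tail of some edge of color $c$, and to $(c,\mathrm{in})$ iff $v$ is the head of some edge of color $c$. Girth is the length of a shortest cycle, $\infty$ for acyclic graphs; the girth of a disconnected graph is the minimum over its components. *)

(* Defs.v *)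
From mathcomp Require Import all_boot.

Set Implicit Arguments.
Unset Strict Implicit.
Unset Printing Implicit Defensive.

(* Extended natural numbers, with None playing the role of infinity. *)
Definition enat := option nat.

Definition leoo (x y : enat) : bool :=
  match x, y with
  | _, None => true
  | None, Some _ => false
  | Some m, Some n => m <= n
  end.

Section Graph.
Variable T : finType.
Implicit Type e : rel T.

Definition edges e : {set {set T}} :=
  [set [set p.1; p.2] | p : T * T & e p.1 p.2].

Definition has_cycle e n : bool := [exists c : n.-tuple T, ucycleb e c].

(* For a symmetric e, ucycleb accepts the closed walk x, y, x of length 2, so
   lengths start at 3; a simple cycle has length at most #|T|, so the range of
   lengths is exhaustive (see girth_SomeP and girth_NoneP). *)
Definition girth e : enat := ohead [seq n <- iota 3 #|T| | has_cycle e n].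

(* d x y means that the edge {x, y} is directed from x to y. *)
Definition orientation e (d : rel T) : Prop :=
  (forall x y, e x y = d x y || d y x) /\ (forall x y, ~~ (d x y && d y x)).

Lemma has_cycleP e n :
  reflect (exists2 c : seq T, ucycle e c & size c = n) (has_cycle e n).
Proof.
apply: (iffP existsP) => [[c ec]|[c ec sc]].
  by exists c => //; rewrite size_tuple.
by move/eqP: sc => sc; exists (Tuple sc).
Qed.

Lemma has_cycle_leq e n : has_cycle e n -> n <= #|T|.
Proof. by case/has_cycleP=> c /andP[_ /card_uniqP <-] <-; apply: max_card. Qed.

Let lengths e := [seq n <- iota 3 #|T| | has_cycle e n].

Let mem_lengths e n : (n \in lengths e) = (2 < n) && has_cycle e n.
Proof.
rewrite mem_filter mem_iota andbC -andbA; congr (_ && _).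
case en: (has_cycle e n); rewrite ?andbF // andbT.
exact: leq_trans (has_cycle_leq en) (leq_addl 2 _).
Qed.

Lemma girth_SomeP e n :
  girth e = Some n <->
  [/\ 2 < n, has_cycle e n & forall m, 2 < m -> has_cycle e m -> n <= m].
Proof.
have srt : sorted ltn (lengths e).
  by apply: sorted_filter (iota_ltn_sorted _ _); apply: ltn_trans.
rewrite /girth -/(lengths e).
case: (lengths e) srt (mem_lengths e) => [|k s] /= srt memE.
  by split=> // -[n_gt2 en _]; have := memE n; rewrite n_gt2 en.
have /esym/andP[k_gt2 ek]: true = (2 < k) && has_cycle e k.
  by rewrite -memE mem_head.
have min_k m : 2 < m -> has_cycle e m -> k <= m.
  move=> m_gt2 em; have := memE m; rewrite em m_gt2 inE.
  by case/predU1P=> [-> //|/(allP (order_path_min ltn_trans srt))/ltnW].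
split=> [[<-] //|[n_gt2 en min_n]].
by congr Some; apply/eqP; rewrite eqn_leq min_k ?min_n.
Qed.

Lemma girth_NoneP e :
  girth e = None <-> (forall n, 2 < n -> ~~ has_cycle e n).
Proof.
split=> [gN n n_gt2|acyc]; last first.
  by case ge: (girth e) => [n|//]; have /girth_SomeP[/acyc/negP] := ge.
apply/negP=> en; have: n \in lengths e by rewrite mem_lengths n_gt2.
by move: gN; rewrite /girth -/(lengths e); case: (lengths e).
Qed.

End Graph.

Record product_structure (A B : finType) := ProductStructure {
  cells :> {set {set A * B}};
  cells_partition : partition cells [set: A * B];
  cells_transverse : forall C p q, C \in cells -> p \in C -> q \in C ->
    p != q -> p.1 != q.1 /\ p.2 != q.2
}.

Section ProductStructure.
Variables (A B : finType) (Pi : product_structure A B).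

Definition even_structure : Prop := forall C, C \in cells Pi -> #|C| = 2.

Definition odd_structure : Prop :=
  exists C0, [/\ C0 \in cells Pi, #|C0| = 1
               & forall C, C \in cells Pi -> C != C0 -> #|C| = 2].

(* p != q is needed: [set p; p] is a cell when p is alone in its cell. *)
Definition two_cell (p q : A * B) : bool :=
  (p != q) && ([set p; q] \in cells Pi).

Definition LA : rel A :=
  [rel a a' | [exists b, exists b', two_cell (a, b) (a', b')]].

Definition LB : rel B :=
  [rel b b' | [exists a, exists a', two_cell (a, b) (a', b')]].

Definition LAB : rel (A + B) := fun u v =>
  match u, v with
  | inl a, inl a' => LA a a'
  | inr b, inr b' => LB b b'
  | _, _ => false
  end.

(* The edges of LA and LB are handled as edges of LAB, i.e. as two-element
   subsets of A + B. *)
Definition opposite : rel {set A + B} := fun e f =>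
  [exists p : A * B, exists q : A * B,
    [&& two_cell p q, e == [set inl p.1; inl q.1]
      & f == [set inr p.2; inr q.2]]].

Definition same_color : rel {set A + B} :=
  connect (fun e f => opposite e f || opposite f e).

Definition colors : {set {set {set A + B}}} :=
  equivalence_partition same_color (edges LAB).

Definition color : finType := {c : {set {set A + B}} | c \in colors}.

Definition coherent_orientation (O : rel (A + B)) : Prop :=
  orientation LAB O /\
  forall a b a' b', two_cell (a, b) (a', b') ->
    O (inl a) (inl a') /\ O (inr b) (inr b') \/
    O (inl a') (inl a) /\ O (inr b') (inr b).

Definition no_fold (O : rel (A + B)) : Prop :=
  forall (c : color) (v w w' : A + B),
    [set v; w] \in val c -> [set v; w'] \in val c ->
    (O v w -> O v w' -> w = w') /\ (O w v -> O w' v -> w = w').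

(* A signed color is a pair (c, s) with s = true for "out", false for "in". *)
Definition has_signed_color (O : rel (A + B)) (v : A + B) (cs : color * bool) :=
  [exists w, (if cs.2 then O v w else O w v) && ([set v; w] \in val cs.1)].

Definition L1 (O : rel (A + B)) : rel ((A + B) + color * bool) := fun x y =>
  match x, y with
  | inl v, inr cs | inr cs, inl v => has_signed_color O v cs
  | _, _ => false
  end.

Definition admissible (O : rel (A + B)) : Prop :=
  [/\ coherent_orientation O, no_fold O, even_structure \/ odd_structure,
      2 <= #|A| & 2 <= #|B|].

Lemma two_cell_sym : symmetric two_cell.
Proof. by move=> p q; rewrite /two_cell eq_sym setUC. Qed.

Lemma LAB_sym : symmetric LAB.
Proof.
suff [sA sB] : symmetric LA /\ symmetric LB by case=> [a|b] [a'|b'] //=.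
by split=> x y; apply/existsP/existsP => -[b /existsP[b' h]];
   exists b'; apply/existsP; exists b; rewrite two_cell_sym.
Qed.

Lemma LAB_irr : irreflexive LAB.
Proof.
by case=> x; apply/negbTE/existsP => -[y /existsP[y' /andP[ne h]]];
   have [] := cells_transverse h (set21 _ _) (set22 _ _) ne; rewrite /= eqxx.
Qed.

Lemma same_color_equiv : equivalence_rel same_color.
Proof.
move=> e f g; split; first exact: connect0.
move=> ef; apply: (same_connect _ ef).
by apply: sym_connect_sym => e' f'; apply: orbC.
Qed.

Lemma opposite_edges e f :
  opposite e f -> (e \in edges LAB) && (f \in edges LAB).
Proof.
case/existsP=> -[a b] /existsP[[a' b'] /and3P[h /eqP-> /eqP->]]; apply/andP.
split; apply/imsetP; [exists (inl a, inl a') | exists (inr b, inr b')] => //;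
  rewrite inE /=; apply/existsP.
  by exists b; apply/existsP; exists b'.
by exists a; apply/existsP; exists a'.
Qed.

End ProductStructure.

Arguments L1 {A B} Pi O.

Definition excluded_girth (p : nat) : Prop :=
  ~ exists (A B : finType) (Pi : product_structure A B) (O : rel (A + B)),
      [/\ admissible Pi O, leoo (Some p) (girth (LAB Pi))
        & leoo (Some 6) (girth (L1 Pi O))].

(* Least element of {p >= 3 | excluded_girth p}, as a predicate so that the
   existence of this number need not be known beforehand. *)
Definition is_pstar (p : nat) : Prop :=
  [/\ 3 <= p, excluded_girth p
    & forall q, 3 <= q -> excluded_girth q -> p <= q].

(* Main.v *)
(* Write d(x) for the number of signed colors at a vertex x.  Each position
   (a, b), except at most one, lies in a 2-cell, and the color of that cell is
   the only signed color shared by a and b; so B is covered by the sets B_s of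
   vertices carrying s, for s ranging over the signed colors at a.  If a <> a'
   share no signed color, b |-> (s, s') gives |B| <= d(a) d(a'), since L1 has no
   4-cycle; if they share s then |B| - |B_s| <= (d(a) - 1) (d(a') - 1), and
   |B_s| = |B_s*| for the opposite sign s*, which a or a' does not carry, so
   |B_s| <= max(d(a), d(a')) and again |B| <= d(a) d(a').  As a has at least
   d(a) neighbours in L_A, the Moore bound |A| > sum_{a' ~ a} d(a') gives
   |A| > |B|.  By symmetry |B| > |A|, a contradiction.  The exceptional position
   costs at most 1 in all of this, which d(a) >= 2 absorbs.

   For p* > 4, let A and B each consist of the lines of two parallel classes of
   the affine plane over F_4.  A position (a, b) has a meeting point s, and
   its cell pairs it with (a', b'), where a' and b' are the lines through the
   translated point s + (1, 0) in the classes of A and of B not containing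
   a and b.  Then L_A = L_B = K_{4,4} and the signed colors are the 16 points;
   two lines share at most one point, so L1 has girth at least 6. *)

Require Import Defs.
From mathcomp Require Import all_boot zify.

Set Implicit Arguments.
Unset Strict Implicit.
Unset Printing Implicit Defensive.

(** * The counting argument *)

(** Choosing a related element for each [x] is injective, so a bound on cardinals needs only a
    relation and no explicit map. *)
Lemma leq_card_rel (T U : finType) (X : {set T}) (Y : {set U})
    (R : T -> U -> bool) :
  (forall x, x \in X -> exists2 y, y \in Y & R x y) ->
  (forall x x' y, x \in X -> x' \in X -> R x y -> R x' y -> x = x') ->
  #|X| <= #|Y|.
Proof.
move=> totR injR; pose f x := [pick y in Y | R x y].
have fP x : x \in X -> exists y, [/\ y \in Y, R x y & f x = Some y].
  move=> xX; rewrite /f; case: pickP => [y /andP[yY Rxy]|none].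
    by exists y.
  by have [y yY Rxy] := totR x xX; have := none y; rewrite yY Rxy.
rewrite -(card_in_imset (f := f)) => [|x x' xX x'X eqf]; last first.
  have [y [_ Rxy fx]] := fP x xX; have [y' [_ Rxy' fx']] := fP x' x'X.
  by move: eqf; rewrite fx fx' => -[yy']; subst y'; apply: injR Rxy Rxy'.
rewrite -(card_imset (mem Y) Some_inj); apply/subset_leq_card/subsetP=> o.
case/imsetP=> x xX ->; have [y [yY _ ->]] := fP x xX.
exact: imset_f.
Qed.

(** Equivalently, the bipartite incidence graph of [r] has no 4-cycle. *)
Definition linear_incidence (V S : Type) (r : V -> S -> bool) :=
  forall v w s t, r v s -> r w s -> r v t -> r w t -> v = w \/ s = t.

(** * The Moore bound for graphs without triangles and 4-cycles *)

Section Moore.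
Variables (T : finType) (e : rel T).
Hypotheses (e_sym : symmetric e) (e_irr : irreflexive e).
Hypothesis no_triangle : forall x y z, e x y -> e y z -> ~~ e z x.
Hypothesis no_square :
  forall x y z t, e x y -> e y z -> e z t -> e t x -> x = z \/ y = t.

Lemma moore_bound x :
  \sum_(y | e x y) #|[set z | e y z]| < #|T|.
Proof.
rewrite (eq_bigr (fun y => \sum_(z | e y z) 1)) => [|y _]; last first.
  by rewrite sum1dep_card.
rewrite pair_big_dep sum1dep_card /= -cardsT [X in _ < X](cardsD1 x) inE add1n ltnS.
(* A walk x, y, z is sent to its endpoint z, except that x, y, x goes to y. *)
apply: (leq_card_rel (R := fun p z => z == if p.2 == x then p.1 else p.2)).
  case=> y z; rewrite inE /= => /andP[xy yz].
  exists (if z == x then y else z) => //; rewrite !inE andbT.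
  case: (eqVneq z x) => [_|//].
  by apply: contraTneq xy => ->; rewrite e_irr.
case=> [y z] [y' z'] u; rewrite !inE /= => /andP[xy yz] /andP[xy' yz'].
have tri v w : e x v -> e v w -> e x w = false.
  by move=> xv vw; rewrite e_sym; apply/negbTE/(no_triangle xv vw).
case: (eqVneq z x) => [->|zx]; case: (eqVneq z' x) => [->|z'x] /eqP-> /eqP.
- by move->.
- by move=> E; move: xy; rewrite E (tri y').
- by move=> E; move: xy'; rewrite -E (tri y).
move=> E; subst z'; case: (@no_square x y z y') => //; rewrite 1?e_sym //.
  by move=> E; rewrite E eqxx in zx.
by move->.
Qed.

End Moore.

(** * The inequality |B| < |A| for abstract signed colors: [bar] changes the sign, and only [p0] may
    be uncovered *)

Section Counting.
Variables (A B S : finType) (rA : A -> S -> bool) (rB : B -> S -> bool).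
Variables (bar : S -> S) (e : rel A) (p0 : A * B).
Hypotheses (linA : linear_incidence rA) (linB : linear_incidence rB).
Hypothesis barN : forall s, bar s != s.
Hypothesis card_bar : forall s, #|[set b | rB b s]| <= #|[set b | rB b (bar s)]|.
Hypothesis cover : forall a b, (a, b) != p0 -> exists s, rA a s && rB b s.
Hypothesis deg_e : forall a, #|[set s | rA a s]| <= #|[set a' | e a a']|.
Hypotheses (e_sym : symmetric e) (e_irr : irreflexive e).
Hypothesis no_triangle : forall x y z, e x y -> e y z -> ~~ e z x.
Hypothesis no_square :
  forall x y z t, e x y -> e y z -> e z t -> e t x -> x = z \/ y = t.
Hypotheses (A_gt1 : 1 < #|A|) (B_gt1 : 1 < #|B|).

Let sA a := [set s | rA a s].
Let sB s := [set b | rB b s].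
Let hole a := [set b | (a, b) == p0].

Lemma card_hole a : #|hole a| <= (a == p0.1).
Proof.
case: (eqVneq a p0.1) => [->|/negbTE ne].
  rewrite -[nat_of_bool _]/1 -(cards1 p0.2); apply/subset_leq_card/subsetP=> b.
  by rewrite !inE => /eqP <-.
by rewrite leqn0 cards_eq0; apply/eqP/setP=> b; rewrite !inE -pair_eqE /= ne.
Qed.

Lemma hole0 a : a != p0.1 -> hole a = set0.
Proof.
move=> /negbTE ne; apply/eqP; rewrite -cards_eq0 -leqn0.
by rewrite (leq_trans (card_hole a)) // ne.
Qed.

Lemma coverP a b : b \notin hole a -> exists2 s, s \in sA a & rB b s.
Proof. by rewrite inE => /cover[s /andP[*]]; exists s; rewrite ?inE. Qed.

(* If s were the only signed color at a, then s, hence also bar s, would be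
   carried by all of B. *)
Lemma card_sA_gt1 a : a != p0.1 -> 1 < #|sA a|.
Proof.
move=> ne; have cov b : exists2 s, s \in sA a & rB b s.
  by apply: coverP; rewrite hole0 ?inE.
have /card_gt0P[b0 _] : 0 < #|B| by exact: ltnW.
have [s sa b0s] := cov b0.
rewrite ltnNge; apply/negP=> /card_le1_eqP one.
have bs b : rB b s by have [t ta] := cov b; rewrite (one t s ta sa).
have bs' b : rB b (bar s).
  have full : #|[set b | rB b s]| = #|B|.
    by rewrite -cardsT; congr #|pred_of_set _|; apply/setP=> c; rewrite !inE bs.
  have : [set b | rB b (bar s)] == setT.
    by rewrite eqEcard subsetT cardsT -full card_bar.
  by move/eqP/setP/(_ b); rewrite !inE.
have /card_gt1P[b [b' [_ _ bb']]] := B_gt1.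
have [E|E] := linB (bs b) (bs b') (bs' b) (bs' b').
  by rewrite E eqxx in bb'.
by have := barN s; rewrite -E eqxx.
Qed.

(** Outside the hole, a vertex [b] carrying [t] shares some [s] with [a], and [s] differs from [t];
    by [linB], [s] determines [b]. *)
Lemma card_sB_le a t : ~~ rA a t -> #|sB t| <= #|sA a| + #|hole a|.
Proof.
move=> at'; rewrite -(cardsID (hole a)) addnC leq_add //.
  apply: (leq_card_rel (R := fun b s => rA a s && rB b s)) => [b|b b' s].
    rewrite in_setD => /andP[/coverP[s sa bs] _]; exists s => //.
    by rewrite inE in sa; rewrite sa bs.
  move=> /setDP[bt _] /setDP[b't _] /andP[as_ bs] /andP[_ b's].
  rewrite !inE in bt b't; have [//|E] := linB bs b's bt b't.
  by rewrite -E as_ in at'.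
exact/subset_leq_card/subsetIr.
Qed.

Lemma leq_card_mul a a' : a != a' -> a != p0.1 ->
  #|B| <= #|sA a| * #|sA a'| + (a' == p0.1).
Proof.
move=> ne ap0; apply: leq_trans (leq_add (leqnn _) (card_hole a')); rewrite -cardsT.
have cov b : b \notin hole a' ->
    exists2 p, p \in setX (sA a) (sA a') & rB b p.1 && rB b p.2.
  case/coverP=> t ta' bt; have [|s sa bs] := @coverP a b.
    by rewrite hole0 ?inE.
  by exists (s, t); rewrite ?in_setX ?sa ?ta' ?bs.
(* Two distinct signed colors at a vertex of [B] determine it, by [linB]. *)
pose R b (p : S * S) := [&& rB b p.1, rB b p.2 & p.1 != p.2].
have inj b b' p : R b p -> R b' p -> b = b'.
  move=> /and3P[b1 b2 /eqP np] /and3P[b'1 b'2 _].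
  by case: (linB b1 b'1 b2 b'2).
case: (pickP [pred s | rA a s && rA a' s]) => [s /= /andP[sa sa']|none].
  have uniq_s t : rA a t -> rA a' t -> t = s.
    move=> ta ta'; case: (linA sa sa' ta ta') => // E.
    by rewrite E eqxx in ne.
  (* Since [a] and [a'] share only [s], one of them misses [bar s], and [card_sB_le] bounds
     [sB (bar s)], which is at least as large. *)
  have sB_le : #|sB s| <= #|sA a| \/ #|sB s| <= #|sA a'| + #|hole a'|.
    case ab: (rA a (bar s)); last first.
      left; apply: leq_trans (card_bar s) _.
      by have := card_sB_le (negbT ab); rewrite hole0 // cards0 addn0.
    right; apply: leq_trans (card_bar s) (card_sB_le _); apply/negP=> a'b.
    by have := barN s; rewrite (uniq_s _ ab a'b) eqxx.
  have : #|~: hole a' :\: sB s| <= #|setX (sA a :\ s) (sA a' :\ s)|.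
    apply: (leq_card_rel (R := R)) => [b|b b' p _ _]; last exact: inj.
    case/setDP=> + bs; rewrite inE => /cov[p pX /andP[b1 b2]]; rewrite inE in bs.
    have n1 : p.1 != s by apply: contraNneq bs => <-.
    have n2 : p.2 != s by apply: contraNneq bs => <-.
    move: pX; rewrite !inE => /andP[p1 p2].
    exists p; rewrite ?inE ?n1 ?n2 ?p1 // /R b1 b2 /=.
    apply: contraNneq n1 => E; apply/eqP/uniq_s => //; by rewrite E.
  rewrite cardsX; have := cardsC (hole a'); have := cardsID (sB s) (~: hole a').
  have := subset_leq_card (subsetIr (~: hole a') (sB s)).
  have := card_sA_gt1 ap0; have := card_hole a'.
  rewrite cardsT -/(sB _).
  have := cardsD1 s (sA a); have := cardsD1 s (sA a').
  rewrite !(@in_set S) sa sa'.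
  move: sB_le; move: #|sB s| #|sA a| #|sA a'| #|hole a'| #|B| => l d d' h n.
  move: #|_ :\: _| #|_ :&: _| #|~: _| #|_ :\ s| #|_ :\ s| => u v w x y.
  move=> l_le d'E dE h_le d_gt1 v_le vuw hw u_le.
  have h_le1 : h <= 1 by rewrite (leq_trans h_le) ?leq_b1.
  (* In the second case of [l_le] the hole is counted twice; the slack [h <= 1 < d] pays for it. *)
  by rewrite dE d'E; nia.
have : #|~: hole a'| <= #|setX (sA a) (sA a')|.
  apply: (leq_card_rel (R := R)) => [b|b b' p _ _]; last exact: inj.
  rewrite inE => /cov[p pX /andP[b1 b2]]; exists p; rewrite // /R b1 b2 /=.
  move: pX; rewrite !inE => /andP[p1 p2]; apply: contraFneq (none p.1) => E /=.
  by rewrite p1 E.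
rewrite cardsX cardsT; have := cardsC (hole a'); lia.
Qed.

Theorem card_lt : #|B| < #|A|.
Proof.
(* Off the row of [p0], every position is covered and [a] carries at least two signed colors. *)
have [a ap0] : exists a, a != p0.1.
  have /card_gt1P[x [y [_ _ xy]]] := A_gt1.
  by case: (eqVneq x p0.1) => [E|]; [exists y; rewrite -E eq_sym | exists x].
apply: leq_ltn_trans (moore_bound e_sym e_irr no_triangle no_square a).
have : \sum_(a' | e a a') #|B| <=
       \sum_(a' | e a a') (#|sA a| * #|sA a'| + (a' == p0.1)).
  apply: leq_sum => a' aa'; apply: leq_card_mul => //.
  by apply: contraTneq aa' => ->; rewrite e_irr.
rewrite sum_nat_cond_const cardsE big_split -big_distrr /=.
have : \sum_(a' | e a a') (a' == p0.1 : nat) <= 1.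
  rewrite -big_mkcondr /= sum1dep_card.
  rewrite -(cards1 p0.1); apply/subset_leq_card/subsetP=> a'.
  by rewrite !inE => /andP[].
have : \sum_(a' | e a a') #|sA a'| <= \sum_(a' | e a a') #|[set z | e a' z]|.
  by apply: leq_sum => a' _; apply: deg_e.
have := deg_e a; have := card_sA_gt1 ap0; rewrite -/(sA a) [#|[set _ | _]|]cardsE.
move=> d_gt1 d_le sum_le one prod_le; apply: leq_trans sum_le.
(* Otherwise adding |B| over the at least d(a) neighbours of [a] forces d(a) <= 1, the 1 being the
   contribution of [p0]. *)
rewrite leqNgt; apply/negP=> sum_lt.
have := leq_mul d_le (leqnn #|B|); have := leq_mul (leqnn #|sA a|) sum_lt.
rewrite mulnS => lo hi; have := leq_trans lo (leq_trans hi prod_le).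
by rewrite addnC leq_add2l leqNgt (leq_ltn_trans one).
Qed.

End Counting.

(** * Girth and signed colors *)

Lemma girth_geP (T : finType) (e : rel T) k :
  leoo (Some k) (girth e) <-> (forall n, 2 < n < k -> ~~ has_cycle e n).
Proof.
case gE: (girth e) => [g|] /=; last first.
  by move/girth_NoneP: gE => gE; split=> // _ n /andP[/gE].
have [g_gt2 eg min_g] := (girth_SomeP e g).1 gE.
split=> [le_kg n /andP[n_gt2 n_ltk]|acyc].
  by apply/negP=> /(min_g _ n_gt2); rewrite leqNgt (leq_trans n_ltk).
by rewrite leqNgt; apply: contraL eg => lt_gk; rewrite acyc // g_gt2.
Qed.

Lemma girth_ge5_no_triangle (T : finType) (e : rel T) : irreflexive e ->
  leoo (Some 5) (girth e) -> forall x y z, e x y -> e y z -> ~~ e z x.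
Proof.
move=> irr /girth_geP/(_ 3 isT)/has_cycleP acyc x y z xy yz.
apply/negP=> zx; case: acyc; exists [:: x; y; z] => //.
have ne u v : e u v -> u != v by apply: contraTneq => ->; rewrite irr.
by rewrite /ucycle /= xy yz zx !inE !negb_or ne // (eq_sym x) !ne.
Qed.

Lemma girth_ge5_no_square (T : finType) (e : rel T) : irreflexive e ->
  leoo (Some 5) (girth e) ->
  forall x y z t, e x y -> e y z -> e z t -> e t x -> x = z \/ y = t.
Proof.
move=> irr /girth_geP/(_ 4 isT)/has_cycleP acyc x y z t xy yz zt tx.
have [xz|xz] := eqVneq x z; [by left | right]; apply/eqP/negPn/negP=> yt.
have ne u v : e u v -> u != v by apply: contraTneq => ->; rewrite irr.
case: acyc; exists [:: x; y; z; t] => //.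
rewrite /ucycle /= xy yz zt tx !inE !negb_or xz yt (ne _ _ xy) (ne _ _ yz).
by rewrite (ne _ _ zt) (eq_sym x) (ne _ _ tx).
Qed.

Lemma set2_eq (T : finType) (x y v w : T) : [set x; y] = [set v; w] ->
  x = v /\ y = w \/ x = w /\ y = v.
Proof.
move=> E; have: x \in [set v; w] by rewrite -E set21.
have: y \in [set v; w] by rewrite -E set22.
have: v \in [set x; y] by rewrite E set21.
have: w \in [set x; y] by rewrite E set22.
by rewrite !inE; do 4![case/orP=> /eqP ?]; subst; auto.
Qed.

(** An injective homomorphism sends cycles to cycles of the same length. *)
Lemma girth_map_ge (T U : finType) (e : rel T) (e' : rel U) (f : T -> U) k :
  injective f -> {homo f : x y / e x y >-> e' x y} ->
  leoo (Some k) (girth e') -> leoo (Some k) (girth e).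
Proof.
move=> inj_f hom /girth_geP acyc; apply/girth_geP=> n /acyc; apply: contra.
case/has_cycleP=> c /andP[cyc uniq_c] <-; apply/has_cycleP.
exists (map f c); rewrite ?size_map // /ucycle map_inj_uniq // uniq_c andbT.
case: c cyc {uniq_c} => //= x c; rewrite -map_rcons path_map.
exact: sub_path.
Qed.

(** * Signed colors of an admissible structure *)

Section Structure.
Variables (A B : finType) (Pi : product_structure A B) (O : rel (A + B)).
Lemma mem_color_class (c : color Pi) e :
  e \in val c -> e \in edges (LAB Pi) /\
    forall f, (f \in val c) = (f \in edges (LAB Pi)) && same_color Pi e f.
Proof.
case/imsetP: (valP c) => e0 e0L ->; rewrite inE => /andP[eL e0e]; split=> // f.
by rewrite inE; congr (_ && _); have [_ ->] := same_color_equiv Pi e0 e f.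
Qed.

Lemma color_edge (c : color Pi) v w : [set v; w] \in val c -> LAB Pi v w.
Proof.
case/mem_color_class=> /imsetP[[x y]]; rewrite inE /= => xy E _.
by case: (set2_eq E) => -[-> ->]; rewrite // LAB_sym.
Qed.

Lemma color_inj (c c' : color Pi) e : e \in val c -> e \in val c' -> c = c'.
Proof.
case/mem_color_class=> _ cE /mem_color_class[_ c'E].
by apply/val_inj/setP=> f; rewrite cE c'E.
Qed.

Hypothesis admO : admissible Pi O.

Lemma O_asym v w : O v w -> O w v = false.
Proof.
by move=> vw; case: admO => -[[_ /(_ v w)]]; rewrite vw => /negbTE.
Qed.

Definition step (v w : A + B) (cs : color Pi * bool) :=
  (if cs.2 then O v w else O w v) && ([set v; w] \in val cs.1).

Lemma has_signed_colorP v cs :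
  reflect (exists w, step v w cs) (has_signed_color O v cs).
Proof. exact: existsP. Qed.

Lemma step_signed_color_inj v w cs cs' : step v w cs -> step v w cs' -> cs = cs'.
Proof.
case: cs cs' => [c s] [c' s'] /andP[/= Os cv] /andP[/= Os' c'v].
rewrite (color_inj cv c'v); congr pair.
by case: s s' Os Os' => -[] // vw; rewrite (O_asym vw).
Qed.

(** This is no-fold at [w], where both edges have the same color and the same direction. *)
Lemma step_source_inj v v' w cs : step v w cs -> step v' w cs -> v = v'.
Proof.
case: admO => _ nf _ _ _ /andP[Ov cv] /andP[Ov' cv'].
rewrite ![[set _; w]]setUC in cv cv'.
by have [out inn] := nf _ _ _ _ cv cv'; case: cs.2 Ov Ov'.
Qed.

Definition opposite_sign (cs : color Pi * bool) := (cs.1, ~~ cs.2).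

Lemma step_opposite v w cs : step v w cs -> step w v (opposite_sign cs).
Proof. by rewrite /step /= setUC; case: cs.2. Qed.

(** * Bounds for one side, with [f] standing for [inl] or [inr] *)

Section Side.
Variables (T : finType) (f : T -> A + B) (eT : rel T).
Hypothesis f_inj : injective f.
Hypothesis LAB_f : forall x w, LAB Pi (f x) w -> exists2 y, eT x y & w = f y.

Let side_step x cs : has_signed_color O (f x) cs ->
  exists y, eT x y /\ step (f x) (f y) cs.
Proof.
case/has_signed_colorP=> w xw; have /andP[_ /color_edge/LAB_f[y xy wE]] := xw.
by exists y; rewrite -wE.
Qed.

Lemma leq_signed_colors_degree x :
  #|[set cs : color Pi * bool | has_signed_color O (f x) cs]| <= #|[set y | eT x y]|.
Proof.
apply: (leq_card_rel (R := fun cs y => step (f x) (f y) cs)) => [cs|cs cs' y _ _].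
  by rewrite inE => /side_step[y [xy st]]; exists y; rewrite ?inE.
exact: step_signed_color_inj.
Qed.

(** By no-fold, the edges of one color match its tails with its heads. *)
Lemma leq_card_opposite_sign cs :
  #|[set x | has_signed_color (Pi := Pi) O (f x) cs]| <=
  #|[set x | has_signed_color O (f x) (opposite_sign cs)]|.
Proof.
apply: (leq_card_rel (R := fun x y => step (f x) (f y) cs)) => [x|x x' y _ _].
  rewrite inE => /side_step[y [xy st]]; exists y; rewrite ?inE //.
  by apply/has_signed_colorP; exists (f x); apply: step_opposite.
by move=> sx sx'; apply/f_inj/(step_source_inj sx sx').
Qed.

Lemma linear_side : leoo (Some 6) (girth (L1 Pi O)) ->
  linear_incidence (fun x => has_signed_color (Pi := Pi) O (f x)).
Proof.
move=> /girth_geP/(_ 4 isT)/has_cycleP acyc x y s t xs ys xt yt.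
have [xy|xy] := eqVneq x y; [by left | right]; apply/eqP/negPn/negP=> st.
case: acyc; exists [:: inl (f x); inr s; inl (f y); inr t] => //.
rewrite /ucycle /= xs ys xt yt !inE !negb_or !eqE /=.
by rewrite (inj_eq f_inj) xy st.
Qed.

End Side.

(** The two edges of a 2-cell at [a] and [b] have the same color and, by coherence, the same
    direction. *)
Lemma coverage :
  exists p0 : A * B, forall a b, (a, b) != p0 ->
    exists cs : color Pi * bool,
      has_signed_color O (inl a) cs && has_signed_color O (inr b) cs.
Proof.
have [[_ coh] _ eo /ltnW/card_gt0P[a1 _] /ltnW/card_gt0P[b1 _]] := admO.
have [p0 two_p0] : exists p0, forall p, p != p0 -> exists q, two_cell Pi p q.
  have [p0 card2] : exists p0, forall p C, C \in cells Pi -> p \in C ->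
      p != p0 -> #|C| = 2.
    case: eo => [ev|[C0 [C0P /eqP/cards1P[p0 C0E] C2]]].
      (* An even structure has no exceptional position, so an arbitrary one serves. *)
      by exists (a1, b1) => p C /ev.
    exists p0 => p C CP pC pp0; apply: C2 => //; apply: contraNneq pp0 => E.
    by rewrite E C0E inE in pC.
  exists p0 => p pp0; have /and3P[/eqP covP _ _] := cells_partition Pi.
  have : p \in cover (cells Pi) by rewrite covP inE.
  case/bigcupP=> C CP pC; have /eqP/cards2P[x [y [xy CE]]] := card2 _ _ CP pC pp0.
  move: pC CP; rewrite CE !inE /two_cell => /orP[]/eqP-> CP.
    by exists y; rewrite xy.
  by exists x; rewrite eq_sym xy setUC.
exists p0 => a b /two_p0[[a' b'] cell].
have opp : opposite Pi [set inl a; inl a'] [set inr b; inr b'].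
  by apply/existsP; exists (a, b); apply/existsP; exists (a', b'); rewrite cell !eqxx.
have /andP[eL fL] := opposite_edges opp.
pose cl := [set f in edges (LAB Pi) | same_color Pi [set inl a; inl a'] f].
have clP : cl \in colors Pi by apply/imsetP; exists [set inl a; inl a'].
pose c : color Pi := Sub cl clP.
have ec : [set inl a; inl a'] \in val c by rewrite SubK inE eL /same_color connect0.
have fc : [set inr b; inr b'] \in val c.
  by rewrite SubK inE fL /same_color connect1 // opp.
by case: (coh _ _ _ _ cell) => -[Oa Ob]; [exists (c, true) | exists (c, false)];
  apply/andP; split; apply/existsP;
  [exists (inl a') | exists (inr b') | exists (inl a') | exists (inr b')];
  rewrite /= ?Oa ?Ob.
Qed.

(** The hypotheses are symmetric in the two sides, so [card_lt] yields opposite strict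
    inequalities. *)
Lemma girth_obstruction : leoo (Some 6) (girth (L1 Pi O)) ->
  leoo (Some 5) (girth (LA Pi)) -> leoo (Some 5) (girth (LB Pi)) -> False.
Proof.
move=> g1 gA gB; have [_ _ _ A_gt1 B_gt1] := admO.
have LAB_inl a w : LAB Pi (inl a) w -> exists2 a', LA Pi a a' & w = inl a'.
  by case: w => // a' aa'; exists a'.
have LAB_inr b w : LAB Pi (inr b) w -> exists2 b', LB Pi b b' & w = inr b'.
  by case: w => // b' bb'; exists b'.
have inlI : injective (@inl A B) by move=> ? ? [].
have inrI : injective (@inr A B) by move=> ? ? [].
have symA : symmetric (LA Pi) by move=> a a'; apply: (LAB_sym Pi (inl a) (inl a')).
have symB : symmetric (LB Pi) by move=> b b'; apply: (LAB_sym Pi (inr b) (inr b')).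
have irrA : irreflexive (LA Pi) by move=> a; apply: (LAB_irr Pi (inl a)).
have irrB : irreflexive (LB Pi) by move=> b; apply: (LAB_irr Pi (inr b)).
have linA := linear_side inlI g1.
have linB := linear_side inrI g1.
have barN cs : opposite_sign cs != cs by case: cs => c []; rewrite xpair_eqE andbF.
have [[a0 b0] cov] := coverage.
have ltBA : #|B| < #|A|.
  apply: (card_lt linA linB barN _ cov _ symA irrA) => //.
  - exact: (leq_card_opposite_sign inrI LAB_inr).
  - exact: (leq_signed_colors_degree LAB_inl).
  - exact: girth_ge5_no_triangle.
  - exact: girth_ge5_no_square.
have: #|A| < #|B|.
  apply: (card_lt (p0 := (b0, a0)) linB linA barN _ _ _ symB irrB) => //.
  - exact: (leq_card_opposite_sign inlI LAB_inl).
  - move=> b a ne; have [|cs csP] := cov a b; first by rewrite xpair_eqE andbC.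
    by exists cs; rewrite andbC.
  - exact: (leq_signed_colors_degree LAB_inr).
  - exact: girth_ge5_no_triangle.
  - exact: girth_ge5_no_square.
by rewrite ltnNge ltnW.
Qed.

End Structure.

(** * Lines of the affine plane over F_4 *)

Definition F4 : finType := (bool * bool)%type.

Definition add4 (u v : F4) : F4 := (u.1 (+) v.1, u.2 (+) v.2).

(* An element (a, b) stands for a + b w with w ^ 2 = w + 1. *)
Definition omega (u : F4) : F4 := (u.2, u.1 (+) u.2).

Definition point : finType := (F4 * F4)%type.

Definition line : finType := (bool * F4)%type.

(* The class cls of A (side = false) consists of the level lines of
   coord false cls, that of B of those of coord true cls. *)
Definition coord (side cls : bool) (s : point) : F4 :=
  match side, cls with
  | false, false => s.1
  | false, true => s.2
  | true, false => add4 s.1 s.2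
  | true, true => add4 s.1 (omega s.2)
  end.

(* The point with coordinates k0 and k1 along the two classes of a side. *)
Definition cross (side : bool) (k0 k1 : F4) : point :=
  if side then let y := omega (add4 k0 k1) in (add4 k0 y, y) else (k0, k1).

(** The intersection point, solved for each pair of classes; applying [omega] twice divides by w, as
    w ^ 3 = 1. *)
Definition meet (a b : line) : point :=
  match a.1, b.1 with
  | false, false => (a.2, add4 a.2 b.2)
  | false, true => (a.2, omega (omega (add4 a.2 b.2)))
  | true, false => (add4 a.2 b.2, a.2)
  | true, true => (add4 (omega a.2) b.2, a.2)
  end.

Definition unit4 : point := ((true, false), (false, false)).

Definition shift (s : point) : point := (add4 s.1 unit4.1, s.2).

Definition partner (side : bool) (u : line) (s : point) : line :=
  (~~ u.1, coord side (~~ u.1) (shift s)).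

(* The point s of u such that shift s lies on v, when u and v cross. *)
Definition tail (side : bool) (u v : line) : point :=
  let k i := if u.1 == i then u.2 else add4 v.2 (coord side i unit4) in
  cross side (k false) (k true).

(* clear s is the one of s and shift s at which edges are outgoing; it is an
   invariant of the color of an edge. *)
Definition clear (s : point) : point := ((false, s.1.2), s.2).

Lemma coord_tail side u v : u.1 != v.1 -> coord side u.1 (tail side u v) = u.2.
Proof. by move: side u v => [] [[] [[] []]] [[] [[] []]]. Qed.

(** In characteristic 2 [shift] is an involution, so the edge read from [v] starts at the shifted
    point. *)
Lemma tail_sym side u v : u.1 != v.1 -> tail side v u = shift (tail side u v).
Proof. by move: side u v => [] [[] [[] []]] [[] [[] []]]. Qed.

Lemma partner_tail side u v : u.1 != v.1 -> partner side u (tail side u v) = v.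
Proof. by move: side u v => [] [[] [[] []]] [[] [[] []]]. Qed.

Lemma tail_partner side u s :
  coord side u.1 s = u.2 -> tail side u (partner side u s) = s.
Proof. by move: side u s => [] [[] [[] []]] [[[] []] [[] []]]. Qed.

Lemma coord_meet a b : coord false a.1 (meet a b) = a.2 /\ coord true b.1 (meet a b) = b.2.
Proof. by move: a b => [[] [[] []]] [[] [[] []]]. Qed.

Lemma meet_through i j s :
  meet (i, coord false i s) (j, coord true j s) = s.
Proof. by move: i j s => [] [] [[[] []] [[] []]]. Qed.

Lemma shiftK : involutive shift.
Proof. by case=> [[[] []] [[] []]]. Qed.

Lemma coord_partner side u s : coord side u.1 s = u.2 ->
  partner side (partner side u s) (shift s) = u.
Proof. by rewrite /partner shiftK negbK /= => ->; case: u. Qed.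

Lemma clear_shift s : clear (shift s) = clear s.
Proof. by rewrite /clear /= addbF. Qed.

Lemma coord2_inj side i side' i' s t : (side, i) != (side', i') ->
  coord side i s = coord side i t -> coord side' i' s = coord side' i' t -> s = t.
Proof.
move=> ne; pose F := [:: (false, false); (false, true); (true, false); (true, true)].
(* A search recovers a point from its two coordinates; this left inverse is checked on single points
   instead of pairs. The default [unit4] is never reached. *)
pose solve k k' := head unit4
  [seq s <- allpairs pair F F | (coord side i s == k) && (coord side' i' s == k')].
suff solveK r : solve (coord side i r) (coord side' i' r) = r.
  by move=> E E'; rewrite -(solveK s) E E' solveK.
by rewrite /solve {solve}; move: side i side' i' ne r => [] [] [] [] // _ [[[] []] [[] []]].
Qed.

(** * Short cycles in bipartite graphs *)

Lemma odd_cycle_2coloring (T : finType) (e : rel T) (f : T -> bool) n :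
  (forall x y, e x y -> f x != f y) -> odd n -> ~~ has_cycle e n.
Proof.
move=> ef on; apply/has_cycleP=> -[[|x c] /andP[/= cyc _] E]; first by rewrite -E in on.
have path_f y s : path e y s -> f (last y s) = f y (+) odd (size s).
  elim: s y => [|z s IH] y /=; first by rewrite addbF.
  by case/andP=> /ef yz /IH ->; move: yz; case: (f y); case: (f z); case: (odd _).
have := path_f _ _ cyc; rewrite last_rcons size_rcons E on.
by case: (f x).
Qed.

Lemma has_cycle4P (T : finType) (e : rel T) : has_cycle e 4 ->
  exists x y z t, [/\ e x y, e y z, e z t, e t x & x != z /\ y != t].
Proof.
case/has_cycleP=> -[|x [|y [|z [|t [|]]]]] //= /andP[/and5P[xy yz zt tx _]].
rewrite /= !inE !negb_or => /and4P[/and3P[_ xz _] /andP[_ yt] _ _] _.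
by exists x, y, z, t.
Qed.

(** Bipartiteness excludes lengths 3 and 5, and a 4-cycle would be two vertices sharing two signed
    colors. *)
Lemma girth_L1_ge6 (A B : finType) (Pi : product_structure A B) (O : rel (A + B)) :
  linear_incidence (has_signed_color (Pi := Pi) O) ->
  leoo (Some 6) (girth (L1 Pi O)).
Proof.
move=> lin; apply/girth_geP.
pose f (x : A + B + color Pi * bool) := if x is inl _ then true else false.
have ef x y : L1 Pi O x y -> f x != f y by case: x y => [?|?] [?|?].
have odd_free n : odd n -> ~~ has_cycle (L1 Pi O) n.
  exact: odd_cycle_2coloring ef.
case=> [|[|[|[|[|[|n]]]]]] // _; [exact: odd_free | | exact: odd_free].
apply/negP=> /has_cycle4P[x [y [z [t [xy yz zt tx [xz yt]]]]]].
move: xy yz zt tx xz yt; case: x => [v|s]; case: y => // y; case: z => // z.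
  case: t => // t vy yz zt tv.
  by case: (lin _ _ _ _ vy yz tv zt) => ->; rewrite eqxx.
case: t => // t sy yz zt ts.
by case: (lin _ _ _ _ sy ts yz zt) => ->; rewrite eqxx.
Qed.

(** * The affine product structure, whose cells are the orbits of a fixed-point-free involution *)

Definition mate (p : line * line) : line * line :=
  (partner false p.1 (meet p.1 p.2), partner true p.2 (meet p.1 p.2)).

Lemma meet_mate p : meet (mate p).1 (mate p).2 = shift (meet p.1 p.2).
Proof. exact: meet_through. Qed.

Lemma mateK : involutive mate.
Proof.
move=> [a b]; have [ca cb] := coord_meet a b.
by rewrite [mate _ in LHS]/mate meet_mate !coord_partner.
Qed.

Lemma mate_transverse p : (mate p).1.1 != p.1.1 /\ (mate p).2.1 != p.2.1.
Proof. by rewrite /=; case: p.1.1; case: p.2.1. Qed.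

Lemma mate_neq p : mate p != p.
Proof. by apply: contraTneq (proj1 (mate_transverse p)) => ->; rewrite eqxx. Qed.

Definition mate_cells : {set {set line * line}} := [set [set p; mate p] | p : line * line].

Lemma mate_cellE p C : C \in mate_cells -> p \in C -> C = [set p; mate p].
Proof.
by case/imsetP=> q _ ->; rewrite !inE => /orP[]/eqP-> //; rewrite mateK setUC.
Qed.

Lemma mate_cells_partition : partition mate_cells [set: line * line].
Proof.
apply/and3P; split.
- apply/eqP/setP=> p; rewrite inE; apply/bigcupP.
  by exists [set p; mate p]; rewrite ?set21 //; apply: imset_f.
- apply/trivIsetP=> C D CP DP; apply: contraR => /pred0Pn[p /andP[/= pC pD]].
  by rewrite (mate_cellE CP pC) (mate_cellE DP pD).
- by apply/imsetP=> -[p _ /setP/(_ p)]; rewrite !inE eqxx.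
Qed.

Lemma mate_cells_transverse C p q :
  C \in mate_cells -> p \in C -> q \in C -> p != q -> p.1 != q.1 /\ p.2 != q.2.
Proof.
move=> CP pC; rewrite (mate_cellE CP pC) !inE => /orP[]/eqP->; rewrite ?eqxx //.
move=> _; have [nA nB] := mate_transverse p.
by split; [apply: contraNneq nA | apply: contraNneq nB] => <-.
Qed.

Definition affine_structure :=
  ProductStructure mate_cells_partition mate_cells_transverse.

Local Notation Pi := affine_structure.
Local Notation vertex := (line + line)%type.

Definition side (v : vertex) : bool := if v is inl _ then false else true.

Definition line_of (v : vertex) : line := match v with inl a => a | inr b => b end.

Lemma vertex_eq u v : side u = side v -> line_of u = line_of v -> u = v.
Proof. by case: u v => u [] v //= _ ->. Qed.

Lemma two_cellE p q : two_cell Pi p q = (q == mate p).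
Proof.
apply/andP/eqP=> [[pq CP]|->]; last first.
  by split; [rewrite eq_sym mate_neq | apply: imset_f].
have /setP/(_ q) := mate_cellE CP (set21 p q).
by rewrite !inE eqxx orbT eq_sym (negbTE pq) => /esym/eqP.
Qed.

Definition crossing (u v : vertex) :=
  (side u == side v) && ((line_of u).1 != (line_of v).1).

Lemma LAB_affine u v : LAB Pi u v = crossing u v.
Proof.
rewrite /crossing; case: u v => [a|b] [a'|b'] //=.
  apply/existsP/idP=> [[b /existsP[b']]|ne].
    rewrite two_cellE => /eqP[-> _]; rewrite eq_sym.
    by have [] := mate_transverse (a, b).
  (* Any line of [B] through [s] gives a position whose cell joins [a] to [a']; one of class [false]
     is taken. *)
  pose s := tail false a a'; exists (false, coord true false s); apply/existsP.
  have E : meet a (false, coord true false s) = s.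
    rewrite -[RHS](meet_through a.1 false); congr meet.
    by rewrite (coord_tail false ne); case: (a).
  exists (mate (a, (false, coord true false s))).2.
  by rewrite two_cellE /mate /= E partner_tail.
apply/existsP/idP=> [[a /existsP[a']]|ne].
  rewrite two_cellE => /eqP[_ ->]; rewrite eq_sym.
  by have [] := mate_transverse (a, b).
pose s := tail true b b'; exists (false, coord false false s); apply/existsP.
have E : meet (false, coord false false s) b = s.
  rewrite -[RHS](meet_through false b.1); congr meet.
  by rewrite (coord_tail true ne); case: (b).
exists (mate ((false, coord false false s), b)).1.
by rewrite two_cellE /mate /= E partner_tail.
Qed.

(** * Orientation and signed colors of the affine structure *)

Definition vtail (u v : vertex) : point := tail (side u) (line_of u) (line_of v).

(** The points [vtail u v] and [vtail v u] differ by [shift], which flips the tested bit, so exactly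
    one direction is chosen. *)
Definition affine_orientation : rel vertex := fun u v =>
  crossing u v && ~~ (vtail u v).1.1.

Local Notation O := affine_orientation.

Lemma crossing_sym : symmetric crossing.
Proof. by move=> u v; rewrite /crossing eq_sym (eq_sym (line_of u).1). Qed.

Lemma vtail_sym u v : crossing u v -> vtail v u = shift (vtail u v).
Proof. by case/andP=> /eqP s /tail_sym <-; rewrite /vtail s. Qed.

Lemma vtail_inj u v v' : crossing u v -> crossing u v' -> vtail u v = vtail u v' -> v = v'.
Proof.
case/andP=> /eqP s ne /andP[/eqP s' ne'] E; apply: vertex_eq; first by rewrite -s -s'.
by rewrite -(partner_tail (side u) ne) -(partner_tail (side u) ne') -/(vtail u v) E.
Qed.

Lemma vtail_on u v : crossing u v ->
  coord (side u) (line_of u).1 (vtail u v) = (line_of u).2.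
Proof. by case/andP=> _ /coord_tail. Qed.

(** Coherence and the invariance of labels under [opposite] both rest on this common point. *)
Lemma tail_mate a b : let p := mate (a, b) in
  vtail (inl a) (inl p.1) = meet a b /\ vtail (inr b) (inr p.2) = meet a b.
Proof. by have [ca cb] := coord_meet a b; split; apply: tail_partner. Qed.

Definition edge_label (s : point) (e : {set vertex}) :=
  [exists u, exists v, [&& e == [set u; v], crossing u v & clear (vtail u v) == s]].

Lemma edge_labelE s u v : crossing u v ->
  edge_label s [set u; v] = (clear (vtail u v) == s).
Proof.
move=> uv; apply/existsP/idP=> [[u' /existsP[v' /and3P[/eqP E u'v' /eqP<-]]]|lab].
  case: (set2_eq E) => -[-> ->] //.
  by rewrite [in clear _](vtail_sym u'v') clear_shift.
by exists u; apply/existsP; exists v; rewrite eqxx uv.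
Qed.

Lemma edge_label_same_color s e f :
  same_color Pi e f -> edge_label s e = edge_label s f.
Proof.
suff opp e' f' : opposite Pi e' f' -> edge_label s e' = edge_label s f'.
  move=> ef; apply: (closed_connect (a := edge_label s) _ ef) => e' f' /orP[/opp|/opp/esym].
    exact.
  exact.
case/existsP=> -[a b] /existsP[q /and3P[cell /eqP-> /eqP->]].
have [EA EB] := tail_mate a b; have [nA nB] := mate_transverse (a, b).
move: cell; rewrite two_cellE => /eqP->.
by rewrite !edge_labelE ?EA ?EB // /crossing eqxx eq_sym.
Qed.

Lemma color_label (c : color Pi) u v u' v' :
  [set u; v] \in val c -> [set u'; v'] \in val c ->
  clear (vtail u v) = clear (vtail u' v').
Proof.
move=> uv u'v'; have [+ +] := (color_edge uv, color_edge u'v').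
rewrite !LAB_affine => cr cr'; apply/esym/eqP; rewrite -edge_labelE //.
rewrite -(@edge_label_same_color _ [set u; v]) ?edge_labelE //.
by have [_ cE] := mem_color_class uv; rewrite cE in u'v'; case/andP: u'v'.
Qed.

Lemma clearK s : ~~ s.1.1 -> clear s = s.
Proof. by case: s => [[[] ?] ?]. Qed.

(** The color fixes the point up to [shift], by [color_label], and the sign selects one of the
    two. *)
Lemma step_vtail u v u' v' (cs : color Pi * bool) :
  step O u v cs -> step O u' v' cs -> vtail u v = vtail u' v'.
Proof.
have norm x y b : (if b then O x y else O y x) ->
    crossing x y /\ vtail x y = if b then clear (vtail x y) else shift (clear (vtail x y)).
  case: b => /andP[cr out]; first by rewrite clearK.
  rewrite crossing_sym cr; split=> //.
  by rewrite (vtail_sym cr) clear_shift clearK.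
case/andP=> /norm[_ ->] cuv /andP[/norm[_ ->] cu'v'].
by rewrite (color_label cuv cu'v').
Qed.

Lemma affine_orientation_orientation : orientation (LAB Pi) O.
Proof.
split=> u v; rewrite ?LAB_affine /O crossing_sym; case cr: (crossing v u) => //=.
  by rewrite (vtail_sym cr) /=; case: (vtail v u).1.1.
by rewrite (vtail_sym cr) /=; case: (vtail v u).1.1.
Qed.

Lemma affine_admissible : admissible Pi O.
Proof.
split.
- split; first exact: affine_orientation_orientation.
  move=> a b a' b'; rewrite two_cellE => /eqP E.
  have [-> ->] : a' = (mate (a, b)).1 /\ b' = (mate (a, b)).2 by rewrite -E.
  have [EA EB] := tail_mate a b; have [nA nB] := mate_transverse (a, b).
  rewrite /O.
  have crA : crossing (inl a) (inl (mate (a, b)).1) by rewrite /crossing eqxx eq_sym.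
  have crB : crossing (inr b) (inr (mate (a, b)).2) by rewrite /crossing eqxx eq_sym.
  rewrite !(crossing_sym (inl (mate _).1)) !(crossing_sym (inr (mate _).2)) crA crB.
  rewrite (vtail_sym crA) (vtail_sym crB) EA EB /=.
  by case: (meet a b).1.1; [right | left].
- move=> c v w w' vw vw'.
  have out : O v w -> O v w' -> w = w'.
    move=> Ovw Ovw'; have := @step_vtail v w v w' (c, true).
    rewrite /step /= Ovw Ovw' => /(_ vw vw'); apply: vtail_inj.
      by case/andP: Ovw.
    by case/andP: Ovw'.
  split=> // Owv Ow'v; have := @step_vtail v w v w' (c, false).
  rewrite /step /= Owv Ow'v => /(_ vw vw'); apply: vtail_inj.
    by rewrite crossing_sym; case/andP: Owv.
  by rewrite crossing_sym; case/andP: Ow'v.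
- by left=> C /imsetP[p _ ->]; rewrite cards2 eq_sym mate_neq.
- by rewrite !card_prod card_bool.
- by rewrite !card_prod card_bool.
Qed.

Lemma affine_linear : linear_incidence (has_signed_color (Pi := Pi) O).
Proof.
move=> v w cs ct /has_signed_colorP[v1 sv] /has_signed_colorP[w1 sw].
move=> /has_signed_colorP[v2 tv] /has_signed_colorP[w2 tw].
have crossing_step x y (c : color Pi * bool) : step O x y c -> crossing x y.
  by case/andP=> _ /color_edge; rewrite LAB_affine.
have Es := step_vtail sv sw; have Et := step_vtail tv tw.
have [E|ne] := eqVneq (side v, (line_of v).1) (side w, (line_of w).1).
  (* Parallel lines with a common point coincide. *)
  left; case: E => Eside Ecls; apply: vertex_eq => //.
  rewrite [LHS]surjective_pairing [RHS]surjective_pairing Ecls; congr pair.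
  rewrite -(vtail_on (crossing_step _ _ _ sv)) -(vtail_on (crossing_step _ _ _ sw)).
  by rewrite Es Eside Ecls.
(* Both points lie on both lines, and lines of different parallel classes share only one point. *)
right; have st : vtail v v1 = vtail v v2.
  apply: (coord2_inj ne).
    by rewrite !vtail_on //; [apply: crossing_step tv | apply: crossing_step sv].
  by rewrite Es Et !vtail_on //; [apply: crossing_step tw | apply: crossing_step sw].
have E : v1 = v2 by apply: vtail_inj st; [apply: crossing_step sv | apply: crossing_step tv].
by apply: (step_signed_color_inj affine_admissible sv); rewrite E.
Qed.

(** The parallel class is a proper 2-coloring, so there are no triangles. *)
Lemma affine_girth_LAB : leoo (Some 4) (girth (LAB Pi)).
Proof.
apply/girth_geP=> -[|[|[|[|n]]]] // _.
apply: (odd_cycle_2coloring (f := fun v => (line_of v).1)) => // u v.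
by rewrite LAB_affine => /andP[].
Qed.

Theorem theoremD :
  [/\ ~ (exists (A B : finType) (Pi : product_structure A B) (O : rel (A + B)),
          [/\ admissible Pi O,
              leoo (Some 6) (girth (L1 Pi O)),
              leoo (Some 5) (girth (LA Pi))
            & leoo (Some 5) (girth (LB Pi))]),
      forall (A B : finType) (Pi : product_structure A B) (O : rel (A + B)),
        admissible Pi O ->
        girth (L1 Pi O) = Some 6 -> leoo (girth (LAB Pi)) (Some 4)
    & is_pstar 5].
Proof.
have obstruction (A B : finType) (Pi : product_structure A B) (O : rel (A + B)) :
    admissible Pi O -> leoo (Some 6) (girth (L1 Pi O)) ->
    leoo (Some 5) (girth (LAB Pi)) -> False.
  move=> adm g1 g5; apply: (girth_obstruction adm g1).
    by apply: (girth_map_ge (f := inl)) g5 => // ? ? [].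
  by apply: (girth_map_ge (f := inr)) g5 => // ? ? [].
split.
- by case=> A [B [Pi [O [adm g1 gA gB]]]]; apply: girth_obstruction adm g1 gA gB.
- move=> A B Pi O adm g6; have := @obstruction A B Pi O adm; rewrite g6 => /(_ isT).
  (* Infinite girth counts as at least 5 and is excluded by the same obstruction. *)
  by case: (girth _) => [g|] /= no; [rewrite leqNgt; apply/negP | case: no].
split=> // [[A [B [Pi [O [adm g5 g6]]]]]|q q_ge3 excl]; first exact: obstruction adm g6 g5.
(* For [q <= 4] the affine structure refutes [excluded_girth q]. *)
rewrite leqNgt; apply/negP=> q_lt5; case: excl.
exists line, line, affine_structure, affine_orientation; split.
- exact: affine_admissible.
- by have := affine_girth_LAB; case: (girth _) => //= g; apply: leq_trans.
- exact: girth_L1_ge6 affine_linear.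
Qed.
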